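(* The internal operad construction $\mathcal{A}\mapsto\mathcal{I}_{\mathcal{A}}$ gives a left adjoint to the functor from the category of closed operads (with operad homomorphisms preserving the closed structure) to the category of extensional $\mathbf{BI}(\_)^\bullet$-algebras (with maps preserving the $\mathbf{BI}(\_)^\bullet$-algebra structure) sending a closed operad $\mathcal{P}$ to the extensional $\mathbf{BI}(\_)^\bullet$-algebra $\mathcal{P}(0)$.
   Context: An extensional $\mathbf{BI}(\_)^\bullet$-algebra is a set $\mathcal{A}$ with a binary application written by juxtaposition (left associative), elements $\mathbf{B},\mathbf{I}$ and a function $a\mapsto a^\bullet$ such that for all $a,b,c$: $\mathbf{I}\,a=a$; $\mathbf{B}\,a\,b\,c=a\,(b\,c)$; $a^\bullet\,b=b\,a$; $\mathbf{B}\,\mathbf{I}=\mathbf{I}$; $(a\,b)^\bullet=\mathbf{B}\,b^\bullet\,(\mathbf{B}\,a^\bullet\,\mathbf{B})$; $\mathbf{B}\,\mathbf{B}^\bullet\,(\mathbf{B}\,\mathbf{B}\,(\mathbf{B}\,\mathbf{B}\,\mathbf{B}))=\mathbf{B}\,(\mathbf{B}\,\mathbf{B})\,\mathbf{B}$; $\mathbf{B}\,\mathbf{I}^\bullet\,\mathbf{B}=\mathbf{I}$; $\mathbf{B}\,a^{\bullet\bullet}\,\mathbf{B}=\mathbf{B}\,(\mathbf{B}\,a^\bullet)\,\mathbf{B}$. Morphisms are maps preserving application, $\mathbf{B}$, $\mathbf{I}$ and $(\_)^\bullet$. Write $a\circ b=\mathbf{B}\,a\,b$ (associative with unit $\mathbf{I}$);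 $\mathbf{B}^0=\mathbf{I}$, $\mathbf{B}^{k+1}=\mathbf{B}\circ\mathbf{B}^k$. A (planar) operad: sets $\mathcal{P}(n)$, $\mathit{id}\in\mathcal{P}(1)$, compositions $g(f_1,\dots,f_n)\in\mathcal{P}(k_1+\dots+k_n)$ with unit and associativity laws. Closed: $\mathbf{app}\in\mathcal{P}(2)$ such that every $p\in\mathcal{P}(n+1)$ has a unique $\lambda(p)\in\mathcal{P}(n)$ with $\mathbf{app}(\lambda(p),\mathit{id})=p$. $\mathcal{P}(0)$ is the extensional $\mathbf{BI}(\_)^\bullet$-algebra with $a\cdot b=\mathbf{app}(a,b)$, $\mathbf{I}=\lambda(\mathit{id})$, $\mathbf{B}=\lambda(\lambda(\lambda(\mathbf{app}(\mathit{id},\mathbf{app}))))$, $a^\bullet=\lambda(\mathbf{app}(\mathit{id},a))$. Internal operad: $\mathcal{I}_{\mathcal{A}}(m)=\{a^\bullet\circ\mathbf{B}^m\mid a\in\mathcal{A}\}$, $\mathit{id}=\mathbf{I}$, $\mathbf{app}=\mathbf{B}$, $g(f_1,\dots,f_n)=f_1\circ(\mathbf{B}\,f_2)\circ\cdots\circ(\mathbf{B}^{n-1}f_n)\circ g$. *)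

(* Defs.v *)
From HB Require Import structures.
From mathcomp Require Import all_boot all_order.
From Stdlib Require Import FunctionalExtensionality ProofIrrelevance.

Set Implicit Arguments.
Unset Strict Implicit.
Unset Printing Implicit Defensive.

Record category := Category {
  obj :> Type;
  hom : obj -> obj -> Type;
  idc : forall X, hom X X;
  compc : forall X Y Z, hom Y Z -> hom X Y -> hom X Z;
  compc1l : forall X Y (f : hom X Y), compc (idc Y) f = f;
  compc1r : forall X Y (f : hom X Y), compc f (idc X) = f;
  compcA : forall X Y Z W (h : hom Z W) (g : hom Y Z) (f : hom X Y),
    compc h (compc g f) = compc (compc h g) f }.

Arguments hom {c}.
Arguments idc {c}.
Arguments compc {c X Y Z}.

Record functor (C D : category) := Functor {
  fobj :> C -> D;
  fmap : forall X Y, hom X Y -> hom (fobj X) (fobj Y);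
  fmap1 : forall X, fmap (idc X) = idc (fobj X);
  fmap_comp : forall X Y Z (g : hom Y Z) (f : hom X Y),
    fmap (compc g f) = compc (fmap g) (fmap f) }.

Arguments fmap {C D} _ {X Y}.

Definition left_adjoint (C D : category) (F : functor C D) (G : functor D C)
    : Prop :=
  exists phi : forall (X : C) (Y : D), hom (F X) Y -> hom X (G Y),
    (forall X Y, bijective (@phi X Y)) /\
    (forall X X' Y Y' (u : hom X' X) (v : hom Y Y') (w : hom (F X) Y),
        phi X' Y' (compc v (compc w (fmap F u)))
        = compc (fmap G v) (compc (phi X Y w) u)).

Reserved Notation "a ⋅ b" (at level 40, left associativity).
Reserved Notation "a ^•" (at level 2, left associativity, format "a ^•").

Record extBI := ExtBI {
  car :> Type;
  ap : car -> car -> car where "a ⋅ b" := (ap a b);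
  cB : car;
  cI : car;
  bul : car -> car where "a ^•" := (bul a);
  apI : forall a, cI ⋅ a = a;
  apB : forall a b c, cB ⋅ a ⋅ b ⋅ c = a ⋅ (b ⋅ c);
  ap_bul : forall a b, a^• ⋅ b = b ⋅ a;
  ax_BI : cB ⋅ cI = cI;
  ax_bul_ap : forall a b, (a ⋅ b)^• = cB ⋅ b^• ⋅ (cB ⋅ a^• ⋅ cB);
  ax_BB : cB ⋅ cB^• ⋅ (cB ⋅ cB ⋅ (cB ⋅ cB ⋅ cB)) = cB ⋅ (cB ⋅ cB) ⋅ cB;
  ax_IB : cB ⋅ cI^• ⋅ cB = cI;
  ax_bul2 : forall a, cB ⋅ a^•^• ⋅ cB = cB ⋅ (cB ⋅ a^•) ⋅ cB }.

Arguments cB {e}.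
Arguments cI {e}.
Notation "a ⋅ b" := (ap a b).
Notation "a ^•" := (bul a).

Record extBI_hom (A A' : extBI) := ExtBIHom {
  ahom :> A -> A';
  ahom_ap : forall a b, ahom (a ⋅ b) = ahom a ⋅ ahom b;
  ahom_B : ahom cB = cB;
  ahom_I : ahom cI = cI;
  ahom_bul : forall a, ahom (a^•) = (ahom a)^• }.

Lemma extBI_hom_ext (A A' : extBI) (f g : extBI_hom A A') : f =1 g -> f = g.
Proof.
case: f g => [f f1 f2 f3 f4] [g g1 g2 g3 g4] /= fg.
have e : f = g by exact: functional_extensionality.
case: _ / e g1 g2 g3 g4 {fg} => g1 g2 g3 g4.
by congr ExtBIHom; exact: proof_irrelevance.
Qed.

Definition extBI_id (A : extBI) : extBI_hom A A.
Proof. by exists id. Defined.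

Definition extBI_comp (A1 A2 A3 : extBI) (g : extBI_hom A2 A3)
  (f : extBI_hom A1 A2) : extBI_hom A1 A3.
Proof.
exists (g \o f) => /= [a b|||a].
- by rewrite !ahom_ap.
- by rewrite !ahom_B.
- by rewrite !ahom_I.
- by rewrite !ahom_bul.
Defined.

Definition extBI_cat : category.
Proof.
by exists extBI extBI_hom extBI_id extBI_comp => *; exact: extBI_hom_ext.
Defined.

(* Laws whose two sides have provably (not definitionally) equal arities are
   stated in the total space [{n & P n}], where [Tagged P x] is [(n, x)] for
   [x : P n]; as [nat] has unique identity proofs, this is the same as equality
   up to transport of the arity.  In [ocompA], [tagnat.sig1 s] and
   [tagnat.sig2 s] are the block containing the position
   [s < \sum_i k i] and the position inside that block
   ([tagnat.rect : s = \sum_(i < sig1 s) k i + sig2 s]). *)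
Record operad := Operad {
  ops :> nat -> Type;
  oid : ops 1;
  ocomp : forall (n : nat) (k : 'I_n -> nat),
    ops n -> (forall i, ops (k i)) -> ops (\sum_(i < n) k i);
  ocomp1l : forall (m : nat) (f : ops m),
    Tagged ops (ocomp oid (fun _ : 'I_1 => f)) = Tagged ops f;
  ocomp1r : forall (n : nat) (g : ops n),
    Tagged ops (ocomp g (fun _ : 'I_n => oid)) = Tagged ops g;
  ocompA : forall (n : nat) (k : 'I_n -> nat)
      (l : forall i : 'I_n, 'I_(k i) -> nat)
      (g : ops n) (f : forall i, ops (k i))
      (h : forall i (j : 'I_(k i)), ops (l i j)),
    Tagged ops (ocomp (ocomp g f)
                  (fun s : 'I_(\sum_(i < n) k i) =>
                     h (tagnat.sig1 s) (tagnat.sig2 s)))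
    = Tagged ops (ocomp g (fun i => ocomp (f i) (h i))) }.

Arguments oid {o}.
Arguments ocomp {o n k}.

Lemma sum_tag2 (P : nat -> Type) (m n : nat) (x : P m) (y : P n) :
  \sum_(i < 2) tag (tnth [tuple Tagged P x; Tagged P y] i) = m + n.
Proof. by rewrite !big_ord_recl big_ord0 addn0. Qed.

(* [g(x, y)] in arity [m + n]. *)
Definition ocomp2 (P : operad) (g : P 2) (m n : nat) (x : P m) (y : P n)
    : P (m + n) :=
  ecast k (P k) (sum_tag2 x y)
    (ocomp g (fun i => tagged (tnth [tuple Tagged P x; Tagged P y] i))).

Record closed_operad := ClosedOperad {
  operad_of :> operad;
  oapp : operad_of 2;
  olam : forall n : nat, operad_of n.+1 -> operad_of n;
  olamP : forall (n : nat) (p : operad_of n.+1),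
    Tagged operad_of (ocomp2 oapp (olam p) oid) = Tagged operad_of p;
  olam_uniq : forall (n : nat) (p : operad_of n.+1) (q : operad_of n),
    Tagged operad_of (ocomp2 oapp q oid) = Tagged operad_of p -> q = olam p }.

Arguments oapp {c}.
Arguments olam {c n}.

(* Preservation of [olam] follows from that of [oapp]: see [ohom_lam]. *)
Record closed_operad_hom (P Q : closed_operad) := ClosedOperadHom {
  ohom :> forall n : nat, P n -> Q n;
  ohom_id : ohom oid = oid;
  ohom_comp : forall (n : nat) (k : 'I_n -> nat) (g : P n)
      (f : forall i, P (k i)),
    ohom (ocomp g f) = ocomp (ohom g) (fun i => ohom (f i));
  ohom_app : ohom oapp = oapp }.

Lemma closed_operad_hom_ext (P Q : closed_operad) (f g : closed_operad_hom P Q) :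
  (forall n, f n =1 g n) -> f = g.
Proof.
case: f g => [f f1 f2 f3] [g g1 g2 g3] /= fg.
have e : f = g.
  apply: functional_extensionality_dep => n.
  exact: functional_extensionality (fg n).
case: _ / e g1 g2 g3 {fg} => g1 g2 g3.
by congr ClosedOperadHom; exact: proof_irrelevance.
Qed.

Definition closed_operad_id (P : closed_operad) : closed_operad_hom P P.
Proof. by exists (fun n => id). Defined.

Definition closed_operad_comp (P Q R : closed_operad)
  (g : closed_operad_hom Q R) (f : closed_operad_hom P Q) :
  closed_operad_hom P R.
Proof.
exists (fun n => g n \o f n) => /= [|n k x y|].
- by rewrite !ohom_id.
- by rewrite !ohom_comp.
- by rewrite !ohom_app.
Defined.

Definition closed_operad_cat : category.
Proof.
by exists closed_operad closed_operad_hom closed_operad_id closed_operad_comp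
  => *; exact: closed_operad_hom_ext.
Defined.

Section OperadTheory.
Variable P : operad.
Local Notation T := {n & P n}.
Local Notation tid := (Tagged P oid).

Lemma Tagged_ecast m n (e : m = n) (x : P m) :
  Tagged P (ecast k (P k) e x) = Tagged P x.
Proof. by case: _ / e. Qed.

Lemma eq_ocomp n (k k' : 'I_n -> nat) (g : P n)
    (f : forall i, P (k i)) (f' : forall i, P (k' i)) :
  (forall i, Tagged P (f i) = Tagged P (f' i)) ->
  Tagged P (ocomp g f) = Tagged P (ocomp g f').
Proof.
move=> ff'.
have e : (fun i => Tagged P (f i)) = (fun i => Tagged P (f' i)).
  exact: functional_extensionality.
exact: (congr1 (fun F : 'I_n -> T =>
  Tagged P (ocomp g (fun i => tagged (F i)))) e).
Qed.

(* Composition on the total space; missing arguments default to [oid]. *)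
Definition tcomp (g : T) (fs : seq T) : T :=
  Tagged P (ocomp (tagged g) (fun i : 'I_(tag g) => tagged (nth tid fs i))).

Lemma tcomp1l x : tcomp tid [:: x] = x.
Proof.
case: x => m x; rewrite -[RHS]ocomp1l; apply: eq_ocomp => i.
by rewrite taggedK; case: i => -[|n] i.
Qed.

Lemma tcomp1r x : tcomp x [::] = x.
Proof.
case: x => m x; rewrite -[RHS]ocomp1r; apply: eq_ocomp => i.
by rewrite nth_nil taggedK.
Qed.


Lemma rect2 (k : 'I_2 -> nat) (s : 'I_(\sum_(i < 2) k i)) :
  s = (if tagnat.sig1 s == 0 :> nat then 0 else k ord0) + tagnat.sig2 s :> nat.
Proof.
rewrite [LHS]tagnat.rect big_mkcond /= !big_ord_recl big_ord0 /=.
by case: (tagnat.sig1 s) (tagnat.sig2 s) => [[|[|//]] /= i] j; rewrite ?addn0.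
Qed.

Lemma tcomp_tcomp2 (g : P 2) (x y : T) hs1 hs2 : size hs1 = tag x ->
  tcomp (tcomp (Tagged P g) [:: x; y]) (hs1 ++ hs2) =
  tcomp (Tagged P g) [:: tcomp x hs1; tcomp y hs2].
Proof.
move=> sz1; pose k (i : 'I_2) := tag (nth tid [:: x; y] i).
pose hh (i : nat) := nth [::] [:: hs1; hs2] i.
pose h (i : 'I_2) (j : 'I_(k i)) := tagged (nth tid (hh i) j).
have := @ocompA P 2 k _ g (fun i => tagged (nth tid [:: x; y] i)) h.
rewrite /tcomp /= => e; apply: etrans (etrans e _); apply: eq_ocomp.
  move=> s; rewrite /h /= !taggedK.
  have := rect2 s.
  case: (tagnat.sig1 s) (tagnat.sig2 s) => [[|[|//]] /= i2] j.
    by rewrite nth_cat sz1 => ->; rewrite add0n ltn_ord.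
  by rewrite nth_cat sz1 => ->; rewrite ltnNge leq_addr addKn.
by case=> -[|[|//]].
Qed.

End OperadTheory.

Section ClosedOperadTheory.
Variable P : closed_operad.
Local Notation T := {n & P n}.
Local Notation tid := (Tagged P oid).

Definition tapp (x y : T) : T := Tagged P (ocomp2 oapp (tagged x) (tagged y)).

Lemma tappE x y : tapp x y = tcomp (Tagged P oapp) [:: x; y].
Proof.
rewrite /tapp Tagged_ecast; apply: eq_ocomp => i.
by rewrite !taggedK (tnth_nth tid) /=; case: x y => [m x] [n y].
Qed.

Lemma tcomp_tapp x y fs hs : size fs = tag x ->
  tcomp (tapp x y) (fs ++ hs) = tapp (tcomp x fs) (tcomp y hs).
Proof. by move=> sz; rewrite !tappE tcomp_tcomp2. Qed.

Lemma tapp_lam n (p : P n.+1) (fs : seq T) (x : T) : size fs = n ->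
  tapp (tcomp (Tagged P (olam p)) fs) x = tcomp (Tagged P p) (rcons fs x).
Proof.
move=> sz; rewrite -{1}[x]tcomp1l -tcomp_tapp // cats1; congr tcomp.
exact: olamP.
Qed.

Lemma tapp_lam0 (p : P 1) (x : T) :
  tapp (Tagged P (olam p)) x = tcomp (Tagged P p) [:: x].
Proof. by rewrite -(@tapp_lam _ _ [::]) // tcomp1r. Qed.

Lemma tapp_inj (x y : T) : tag x = tag y -> tapp x tid = tapp y tid -> x = y.
Proof.
case: x y => [m x] [n y] /= mn; case: n / mn y => y e; congr Tagged.
pose p : P m.+1 := ecast k (P k) (addn1 m) (ocomp2 oapp x oid).
have ep : Tagged P p = Tagged P (ocomp2 oapp x oid) by exact: Tagged_ecast.
exact: etrans (olam_uniq (esym ep)) (esym (olam_uniq (esym (etrans ep e)))).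
Qed.

End ClosedOperadTheory.

Section OperadAlgebra.
Variable P : closed_operad.
Local Notation T := {n & P n}.
Local Notation tid := (Tagged P oid).
Local Notation "x * y" := (tapp x y).

Definition p0_ap (a b : P 0) : P 0 := ocomp2 oapp a b.
Definition p0_I : P 0 := olam oid.
Definition p0_B : P 0 :=
  olam (olam (olam (ocomp2 oapp oid oapp : P 3) : P 2) : P 1).
Definition p0_bul (a : P 0) : P 0 := olam (ocomp2 oapp oid a : P 1).

Lemma p0_apE a b : Tagged P (p0_ap a b) = Tagged P a * Tagged P b.
Proof. by []. Qed.

Lemma p0_IE x : Tagged P p0_I * x = x.
Proof. by rewrite tapp_lam0 tcomp1l. Qed.

Lemma p0_BE x y z : Tagged P p0_B * x * y * z = x * (y * z).
Proof.
rewrite tapp_lam0 (tapp_lam _ _ (fs := [:: x])) //.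
rewrite (tapp_lam _ _ (fs := [:: x; y])) //.
rewrite -[Tagged P _]/(tapp tid (Tagged P oapp)).
by rewrite (tcomp_tapp _ (fs := [:: x])) // tcomp1l -tappE.
Qed.

Lemma p0_bulE a x : Tagged P (p0_bul a) * x = x * Tagged P a.
Proof.
rewrite tapp_lam0 -[Tagged P _]/(tapp tid (Tagged P a)).
by rewrite (@tcomp_tapp P tid _ [:: x] [::]) // tcomp1l tcomp1r.
Qed.

Definition p0_alg : extBI.
Proof.
exists (P 0) p0_ap p0_B p0_I p0_bul => *; apply: eq_from_Tagged;
  have simpE := (p0_apE, p0_IE, p0_BE, p0_bulE).
- by rewrite !simpE.
- by rewrite !simpE.
- by rewrite !simpE.
- by do 2 (apply: tapp_inj; first by []); rewrite !simpE.
- by (apply: tapp_inj; first by []); rewrite !simpE.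
- by do 4 (apply: tapp_inj; first by []); rewrite !simpE.
- by do 2 (apply: tapp_inj; first by []); rewrite !simpE.
- by do 2 (apply: tapp_inj; first by []); rewrite !simpE.
Defined.

End OperadAlgebra.

Section HomTheory.
Variables (P Q : closed_operad) (h : closed_operad_hom P Q).

Lemma ohom_ecast m n (e : m = n) (x : P m) :
  h n (ecast k (P k) e x) = ecast k (Q k) e (h m x).
Proof. by case: _ / e. Qed.

Lemma ohom_Tagged m n (x : P m) (y : P n) :
  Tagged P x = Tagged P y -> Tagged Q (h m x) = Tagged Q (h n y).
Proof.
move=> e.
exact: (congr1 (fun z : {k & P k} => Tagged Q (h (tag z) (tagged z))) e).
Qed.

Lemma ohom_comp2 (g : P 2) m n (x : P m) (y : P n) :
  h _ (ocomp2 g x y) = ocomp2 (h _ g) (h _ x) (h _ y).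
Proof.
apply: eq_from_Tagged; rewrite (ohom_Tagged (Tagged_ecast _ _)) ohom_comp.
rewrite Tagged_ecast; apply: eq_ocomp; case=> -[|[|//]] i;
  by rewrite !(tnth_nth (Tagged _ oid)).
Qed.

Lemma ohom_lam n (p : P n.+1) : h _ (olam p) = olam (h _ p).
Proof.
apply: olam_uniq; rewrite -(ohom_app h) -(ohom_id h) -ohom_comp2.
exact/ohom_Tagged/olamP.
Qed.

Definition p0_hom : extBI_hom (p0_alg P) (p0_alg Q).
Proof.
exists (h 0) => [a b|||a] /=.
- by rewrite /p0_ap (ohom_comp2 oapp a b) ohom_app.
- by rewrite /p0_B !ohom_lam (ohom_comp2 oapp oid oapp) ohom_app ohom_id.
- by rewrite /p0_I ohom_lam ohom_id.
- by rewrite /p0_bul ohom_lam (ohom_comp2 oapp oid a) ohom_app ohom_id.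
Defined.

End HomTheory.

Definition p0_functor : functor closed_operad_cat extBI_cat.
Proof. by exists p0_alg p0_hom => *; exact: extBI_hom_ext. Defined.

Definition circ (A : extBI) (a b : A) : A := cB ⋅ a ⋅ b.
Notation "a ∘ b" := (circ a b) (at level 45, left associativity).

Definition Bpow (A : extBI) (k : nat) : A := iter k (circ cB) cI.

Section ExtBITheory.
Variable A : extBI.
Implicit Types a b c : A.
Local Notation B := (cB : A).
Local Notation I := (cI : A).
Local Notation "'B^ k" := (Bpow A k) (at level 1, k at level 1).

Lemma circE a b c : (a ∘ b) ⋅ c = a ⋅ (b ⋅ c).
Proof. exact: apB. Qed.

Lemma circ_B a : B ∘ (B ⋅ a) = (B ⋅ (B ⋅ a)) ∘ B.
Proof.
have /(congr1 (fun x => x ⋅ a)) := ax_BB A.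
by rewrite /circ !(apB, ap_bul) => <-.
Qed.

Lemma circA : associative (@circ A).
Proof.
move=> a b c; have /(congr1 (fun x => x ⋅ b ⋅ c)) := circ_B a.
by rewrite /circ !apB.
Qed.

Lemma circ1l : left_id I (@circ A).
Proof. by move=> a; rewrite /circ ax_BI apI. Qed.

Lemma circ1r : right_id I (@circ A).
Proof.
move=> a; have /(congr1 (fun x => x ⋅ a)) := ax_IB A.
by rewrite !(apB, ap_bul, apI).
Qed.

HB.instance Definition _ :=
  Monoid.isLaw.Build A I (@circ A) circA circ1l circ1r.

Lemma ap_B_circ a b : B ⋅ (a ∘ b) = (B ⋅ a) ∘ (B ⋅ b).
Proof.
have /(congr1 (fun x => x ⋅ b)) := circ_B a.
by rewrite /circ !apB.
Qed.

Lemma circ_bul a b : a^• ∘ (B ⋅ b) = b ∘ a^•.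
Proof.
have /(congr1 (fun x => x ⋅ b)) := ax_bul2 a.
by rewrite !apB ap_bul.
Qed.

Lemma bul_ap a b : (a ⋅ b)^• = b^• ∘ a^• ∘ B.
Proof. by rewrite ax_bul_ap -circA. Qed.

Lemma BpowS k : 'B^(k.+1) = B ∘ 'B^k. Proof. by []. Qed.

Lemma BpowD j k : 'B^(j + k) = 'B^j ∘ 'B^k.
Proof. by elim: j => [|j IH]; rewrite ?circ1l // addSn BpowS IH circA. Qed.

Lemma Bpow1 : 'B^1 = B. Proof. exact: circ1r. Qed.

Lemma BpowSr k : 'B^(k.+1) = 'B^k ∘ B.
Proof. by rewrite -addn1 BpowD Bpow1. Qed.

Lemma Bpow0_ap a : 'B^0 ⋅ a = a. Proof. exact: apI. Qed.

Lemma BpowS_ap k a : 'B^(k.+1) ⋅ a = B ⋅ ('B^k ⋅ a).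
Proof. exact: circE. Qed.

Lemma BpowSr_ap k a : 'B^(k.+1) ⋅ a = 'B^k ⋅ (B ⋅ a).
Proof. by rewrite BpowSr circE. Qed.

Lemma BpowD_ap j k a : 'B^(j + k) ⋅ a = 'B^j ⋅ ('B^k ⋅ a).
Proof. by rewrite BpowD circE. Qed.

Lemma Bpow_ap1 k : 'B^k ⋅ I = I.
Proof. by elim: k => [|k IH]; rewrite ?Bpow0_ap // BpowS_ap IH ax_BI. Qed.

Lemma Bpow_ap_circ k a b : 'B^k ⋅ (a ∘ b) = ('B^k ⋅ a) ∘ ('B^k ⋅ b).
Proof.
by elim: k => [|k IH]; rewrite ?Bpow0_ap // !BpowS_ap IH ap_B_circ.
Qed.

Lemma Bpow_ap_prod k n (F : 'I_n -> A) :
  'B^k ⋅ (\big[@circ A/I]_(i < n) F i) = \big[@circ A/I]_(i < n) ('B^k ⋅ F i).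
Proof. exact: (big_morph _ (Bpow_ap_circ k) (Bpow_ap1 k)). Qed.

Lemma circ_Bpow k a : 'B^k ∘ (B ⋅ a) = ('B^(k.+1) ⋅ a) ∘ 'B^k.
Proof.
elim: k => [|k IH]; first by rewrite BpowS_ap Bpow0_ap circ1l circ1r.
by rewrite BpowS -circA IH circA BpowS_ap circ_B -!BpowS_ap -circA.
Qed.

(* The subset I_A(m) of [A]. *)
Definition internal (m : nat) (x : A) : Prop := exists a, x = a^• ∘ 'B^m.

Lemma internal_natural m x a : internal m x ->
  x ∘ (B ⋅ a) = ('B^m ⋅ a) ∘ x.
Proof.
by move=> [b ->]; rewrite -circA circ_Bpow BpowS_ap circA circ_bul circA.
Qed.

Lemma internal_apI m x : internal m x -> (x ⋅ I)^• ∘ 'B^m = x.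
Proof. by move=> [a ->]; rewrite circE Bpow_ap1 ap_bul apI. Qed.

Lemma internal_B m x : internal m x -> internal m.+1 (x ∘ B).
Proof. by move=> [a ->]; exists a; rewrite -circA -BpowSr. Qed.

Lemma ap_B_Bpow m :
  (B ⋅ 'B^(m.+1)) ∘ B = B^• ∘ B ∘ (B ⋅ 'B^m) ∘ B ∘ B.
Proof.
have eBB : (B ⋅ B) ∘ B = B^• ∘ (B ∘ (B ∘ B)) by rewrite /circ ax_BB.
by rewrite BpowSr ap_B_circ -circA eBB circA -circ_bul -!circA;
   congr circ; rewrite !circA circ_B.
Qed.

Lemma internal_bul m x a : internal m x -> internal m (x ∘ a^• ∘ B).
Proof.
move=> [b ->]; elim: m a => [|m IH] a.
  by exists (a ⋅ b); rewrite !circ1r bul_ap.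
have -> : b^• ∘ 'B^(m.+1) ∘ a^• ∘ B = b^• ∘ 'B^m ∘ (B ⋅ a)^• ∘ B ∘ B.
  rewrite -(circA b^• 'B^m (B ⋅ a)^•) -(circ_bul (B ⋅ a)) bul_ap.
  by rewrite -(circA b^•) -circ_bul -!circA ap_B_Bpow !circA.
exact: internal_B.
Qed.

Lemma internal_app m k x y : internal m x -> internal k y ->
  internal (m + k) (x ∘ (B ⋅ y) ∘ B).
Proof.
move=> xP [b ->]; elim: k x xP => [|k IH] x xP.
  rewrite addn0 circ1r -circA.
  have -> : (B ⋅ b^•) ∘ B = b^•^• ∘ B by rewrite /circ ax_bul2.
  by rewrite circA; exact: internal_bul.
have -> : x ∘ (B ⋅ (b^• ∘ 'B^(k.+1))) ∘ B
        = (x ∘ B^• ∘ B) ∘ (B ⋅ (b^• ∘ 'B^k)) ∘ B ∘ B.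
  rewrite !(ap_B_circ b^•) -!circA; congr circ.
  rewrite ap_B_Bpow !circA -circ_bul; congr (_ ∘ _ ∘ _ ∘ _).
  by rewrite -!circA circ_B.
by rewrite addnS; apply/internal_B/IH/internal_bul.
Qed.

(* Indices start at 0: this is f_0 ∘ (B f_1) ∘ ... ∘ (B^(n-1) f_(n-1)). *)
Definition internal_prod n (f : 'I_n -> A) : A :=
  \big[@circ A/I]_(i < n) ('B^i ⋅ f i).

Lemma internal_prodS n (f : 'I_n.+1 -> A) :
  internal_prod f =
  internal_prod (fun i => f (widen_ord (leqnSn n) i)) ∘ ('B^n ⋅ f ord_max).
Proof. exact: big_ord_recr. Qed.

Lemma internal_comp n (k : 'I_n -> nat) g (f : 'I_n -> A) :
  internal n g -> (forall i, internal (k i) (f i)) ->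
  internal (\sum_(i < n) k i) (internal_prod f ∘ g).
Proof.
move=> [a ->] fP; rewrite circA; elim: n k f fP => [|n IH] k f fP.
  by rewrite /internal_prod !big_ord0; exists a; rewrite circ1l.
rewrite internal_prodS big_ord_recr /=.
set p := internal_prod _; set y := f ord_max.
have -> : p ∘ ('B^n ⋅ y) ∘ a^• ∘ 'B^(n.+1) = (p ∘ a^• ∘ 'B^n) ∘ (B ⋅ y) ∘ B.
  rewrite -!circA; congr circ.
  rewrite (circA _ a^•) -circ_bul -!circA; congr circ.
  by rewrite [RHS]circA circ_Bpow BpowS_ap -circA -BpowSr.
by apply: internal_app => //; apply: IH => i.
Qed.

Lemma internal_id : internal 1 I.
Proof. by exists I; rewrite Bpow1 /circ ax_IB. Qed.

Lemma internal_oapp : internal 2 B.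
Proof. by exists I; rewrite BpowS Bpow1 circA {2}/circ ax_IB circ1l. Qed.

Lemma internal_prod1 n : internal_prod (fun _ : 'I_n => I) = I.
Proof.
by rewrite /internal_prod big1 // => i _; rewrite Bpow_ap1.
Qed.

Lemma internal_prod_natural n (k : 'I_n -> nat) (f : 'I_n -> A) :
  (forall i, internal (k i) (f i)) -> forall a,
  internal_prod f ∘ ('B^n ⋅ a) =
  ('B^(\sum_(i < n) k i) ⋅ a) ∘ internal_prod f.
Proof.
elim: n k f => [|n IH] k f fP a.
  by rewrite /internal_prod !big_ord0 Bpow0_ap circ1l circ1r.
rewrite internal_prodS big_ord_recr /= BpowD_ap circA.
have /= <- := IH _ _ (fun i => fP (widen_ord (leqnSn n) i)) ('B^(k ord_max) ⋅ a).
rewrite -!circA -!Bpow_ap_circ -(internal_natural _ (fP ord_max)).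
by rewrite Bpow_ap_circ -BpowSr_ap.
Qed.

Lemma sum_widen n (k : 'I_n.+1 -> nat) m : m <= n ->
  \sum_(i < n.+1 | i < m) k i =
  \sum_(i < n | i < m) k (widen_ord (leqnSn n) i).
Proof.
by move=> mn; rewrite big_mkcond big_ord_recr /= ltnNge mn addn0 -big_mkcond.
Qed.

Lemma big_ord_sum n (k : 'I_n -> nat) (F : nat -> A) :
  \big[@circ A/I]_(s < \sum_(i < n) k i) F s =
  \big[@circ A/I]_(i < n) \big[@circ A/I]_(j < k i)
     F (\sum_(i' < n | i' < i) k i' + j).
Proof.
elim: n k => [|n IH] k; first by rewrite !big_ord0.
rewrite !big_ord_recr /= big_split_ord /= IH.
congr circ; last first.
  apply: eq_bigr => j _; rewrite sum_widen //; congr (F (_ + _)).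
  by apply: eq_bigl => i; rewrite ltn_ord.
by apply: eq_bigr => i _; apply: eq_bigr => j _; rewrite sum_widen // ltnW.
Qed.

Lemma internal_prod_circ n (k : 'I_n -> nat) (f H : 'I_n -> A) :
  (forall i, internal (k i) (f i)) ->
  (\big[@circ A/I]_(i < n) ('B^(\sum_(i' < n | i' < i) k i') ⋅ H i))
    ∘ internal_prod f = internal_prod (fun i => H i ∘ f i).
Proof.
elim: n k f H => [|n IH] k f H fP.
  by rewrite /internal_prod !big_ord0 circ1l.
rewrite !internal_prodS big_ord_recr /= Bpow_ap_circ.
have fP' i := fP (widen_ord (leqnSn n) i).
rewrite -(IH _ _ (fun i => H (widen_ord _ i)) fP') -!circA; congr circ.
  by apply: eq_bigr => i _; rewrite sum_widen // ltnW.
rewrite !circA (internal_prod_natural fP') sum_widen //.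
congr (('B^_ ⋅ _) ∘ _ ∘ _).
by apply: eq_bigl => i; rewrite ltn_ord.
Qed.

Lemma internal_prodA n (k : 'I_n -> nat) (f : 'I_n -> A)
    (h : forall i : 'I_n, 'I_(k i) -> A) :
  (forall i, internal (k i) (f i)) ->
  internal_prod (fun s : 'I_(\sum_(i < n) k i) =>
                   h (tagnat.sig1 s) (tagnat.sig2 s)) ∘ internal_prod f =
  internal_prod (fun i => internal_prod (h i) ∘ f i).
Proof.
move=> fP; pose F (s : nat) : A :=
  if insub s is Some s' then h (tagnat.sig1 s') (tagnat.sig2 s') else I.
have -> : internal_prod (fun s : 'I_(\sum_(i < n) k i) =>
    h (tagnat.sig1 s) (tagnat.sig2 s)) =
    \big[@circ A/I]_(i < n) ('B^(\sum_(i' < n | i' < i) k i') ⋅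
                               internal_prod (h i)).
  transitivity (\big[@circ A/I]_(s < \sum_(i < n) k i) ('B^s ⋅ F s)).
    by apply: eq_bigr => s _; rewrite /F valK.
  rewrite (big_ord_sum k (fun s => 'B^s ⋅ F s)); apply: eq_bigr => i _.
  rewrite Bpow_ap_prod; apply: eq_bigr => j _.
  rewrite BpowD_ap; congr (_ ⋅ (_ ⋅ _)).
  rewrite -(tagnat.RankEsum (p_ := k) (i := i) j) /F valK.
  have : tagnat.sig (tagnat.Rank i j) = Tagged (fun i => 'I_(k i)) j.
    exact: tagnat.rankK.
  by rewrite /tagnat.sig1 /tagnat.sig2 => ->.
exact: internal_prod_circ.
Qed.

End ExtBITheory.

Section InternalOperad.
Variable A : extBI.

Definition internal_ops (m : nat) : Type := {x : A | internal m x}.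

Lemma internal_ops_eq m (x y : internal_ops m) : sval x = sval y -> x = y.
Proof.
case: x y => [x xP] [y yP] /= e; case: y / e yP => yP.
by congr exist; exact: proof_irrelevance.
Qed.

Lemma internal_Tagged_eq m n (x : internal_ops m) (y : internal_ops n) :
  m = n -> sval x = sval y -> Tagged internal_ops x = Tagged internal_ops y.
Proof. by move=> e; case: n / e y => y /internal_ops_eq ->. Qed.

Definition internal_ocomp (n : nat) (k : 'I_n -> nat) (g : internal_ops n)
    (f : forall i, internal_ops (k i)) : internal_ops (\sum_(i < n) k i) :=
  exist _ (internal_prod (fun i => sval (f i)) ∘ sval g)
    (internal_comp (svalP g) (fun i => svalP (f i))).

Definition internal_operad : operad.
Proof.
exists internal_ops (exist _ cI (internal_id A)) internal_ocomp.
- move=> m f; apply: internal_Tagged_eq; first by rewrite big_ord1.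
  by rewrite /= /internal_prod big_ord1 Bpow0_ap circ1r.
- move=> n g; apply: internal_Tagged_eq.
    by rewrite sum_nat_const card_ord muln1.
  by rewrite /= internal_prod1 circ1l.
- move=> n k l g f h; apply: internal_Tagged_eq; last first.
    rewrite /= circA; congr circ.
    rewrite -(@internal_prodA A n k (fun i => sval (f i))
                              (fun i j => sval (h i j))) // => i.
    exact: svalP.
  rewrite (sig_big_dep _ _ (fun i j => l i j)) /=.
  by rewrite (reindex _ (onW_bij _ (tagnat.sig_bij (p_ := k)))).
Defined.

Lemma internal_ocomp2 (g : internal_operad 2) m n (x : internal_operad m)
  (y : internal_operad n) :
  sval (ocomp2 g x y) = sval x ∘ (cB ⋅ sval y) ∘ sval g.
Proof.
have sval_ecast p q (e : p = q) (z : internal_operad p) :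
  sval (ecast k (internal_operad k) e z) = sval z by case: _ / e.
rewrite /ocomp2 sval_ecast /= /internal_prod !big_ord_recl big_ord0 circ1r.
by rewrite Bpow0_ap Bpow1.
Qed.

Definition internal_lam m (p : internal_ops m.+1) : internal_ops m :=
  exist _ ((sval p ⋅ cI)^• ∘ Bpow A m) (ex_intro _ _ erefl).

Definition internal_closed_operad : closed_operad.
Proof.
exists internal_operad (exist _ cB (internal_oapp A)) internal_lam.
- move=> n p; apply: internal_Tagged_eq; first by rewrite addn1.
  rewrite internal_ocomp2 /= ax_BI circ1r -circA -BpowSr.
  exact: internal_apI (svalP p).
- move=> n p q /(congr1 (fun z => sval (tagged z))).
  rewrite /= internal_ocomp2 /= ax_BI circ1r => e.
  apply: internal_ops_eq; rewrite /= -e circE.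
  by rewrite ax_BI (internal_apI (svalP q)).
Defined.

End InternalOperad.

Section InternalHom.
Variables (A A' : extBI) (h : extBI_hom A A').

Lemma ahom_circ a b : h (a ∘ b) = h a ∘ h b.
Proof. by rewrite /circ !ahom_ap ahom_B. Qed.

Lemma ahom_Bpow k : h (Bpow A k) = Bpow A' k.
Proof.
by elim: k => [|k IH]; rewrite ?ahom_I // !BpowS ahom_circ IH ahom_B.
Qed.

Lemma ahom_internal m x : internal m x -> internal m (h x).
Proof.
by move=> [a ->]; exists (h a); rewrite ahom_circ ahom_bul ahom_Bpow.
Qed.

Definition internal_map (m : nat) (x : internal_ops A m) : internal_ops A' m :=
  exist _ (h (sval x)) (ahom_internal (svalP x)).

Definition internal_hom :
  closed_operad_hom (internal_closed_operad A) (internal_closed_operad A').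
Proof.
exists internal_map => [|n k g f|]; apply: internal_ops_eq => /=.
- exact: ahom_I.
- rewrite ahom_circ; congr circ.
  rewrite (big_morph h ahom_circ (ahom_I h)); apply: eq_bigr => i _.
  by rewrite ahom_ap ahom_Bpow.
- exact: ahom_B.
Defined.

End InternalHom.

Definition internal_functor : functor extBI_cat closed_operad_cat.
Proof.
by exists internal_closed_operad internal_hom => *;
  apply: closed_operad_hom_ext => m x; exact: internal_ops_eq.
Defined.

(* Main.v *)
From mathcomp Require Import all_boot.
Require Import Defs.

Set Implicit Arguments.
Unset Strict Implicit.
Unset Printing Implicit Defensive.

(** The map [a |-> a^•] identifies [A] with the algebra of nullary operations
    of its internal operad, with inverse [x |-> x ⋅ I].  In a closed operad,
    every [m]-ary operation is [app(... app(p, id) ..., id)] for a unique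
    nullary [p], so a closed homomorphism is determined by its nullary part.
    Conversely, [h : A -> P(0)] extends to [I_A] by sending [x] to
    [app(... app(h (x ⋅ I), id) ..., id)].  This preserves composition because
    [B^k f t y_1 ... y_k = f (t y_1 ... y_k)] for all operations of [P]. *)

Section Unit.
Variable A : extBI.

Lemma internal0_bul (a : A) : internal 0 (a^•).
Proof. by exists a; rewrite circ1r. Qed.

(** By [internal_apI] at arity 0, a nullary [x] equals [(x ⋅ I)^•]. *)
Lemma internal0_eq (x y : internal_ops A 0) :
  sval x ⋅ cI = sval y ⋅ cI -> x = y.
Proof.
move=> e; apply: internal_ops_eq.
by rewrite -(internal_apI (svalP x)) e (internal_apI (svalP y)).
Qed.

Lemma internal_lam_apI m (p : internal_ops A m.+1) :
  sval (internal_lam p) ⋅ cI = sval p ⋅ cI.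
Proof. by rewrite circE Bpow_ap1 ap_bul apI. Qed.

Definition internal_unit_map (a : A) : internal_ops A 0 :=
  exist _ (a^•) (internal0_bul a).

Lemma internal_unit_mapK (x : internal_ops A 0) :
  internal_unit_map (sval x ⋅ cI) = x.
Proof. by apply: internal0_eq; rewrite /= ap_bul apI. Qed.

Definition internal_unit : extBI_hom A (p0_alg (internal_closed_operad A)).
Proof.
exists internal_unit_map => [a b|||a].
- by apply: internal_ops_eq; rewrite [RHS]internal_ocomp2 /= circ_bul bul_ap.
- apply: internal0_eq; rewrite !internal_lam_apI.
  rewrite (@internal_ocomp2 A _ 1 2) /= ap_bul.
  by rewrite !circE ax_BI !apI -/(circ _ _) circ1r.
- by apply: internal0_eq; rewrite internal_lam_apI /= ap_bul.
- apply: internal0_eq; rewrite internal_lam_apI.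
  rewrite (@internal_ocomp2 A _ 1 0) /= ap_bul.
  by rewrite !circE ax_BI !apI -/(circ _ _) circ1r.
Defined.

End Unit.

Section Uncurrying.
Variable P : closed_operad.
Local Notation T := {n & P n}.
Local Notation tid := (Tagged P oid).
Local Notation "x * y" := (tapp x y).

Fixpoint uncurry (m : nat) (p : P 0) : P m :=
  if m is m'.+1
  then ecast k (P k) (addn1 m') (ocomp2 oapp (uncurry m' p) oid) else p.

(** Works on the total space, so the arity casts of [uncurry] disappear. *)
Definition tuncurry (m : nat) (t : T) : T := iter m (fun t => t * tid) t.

Lemma Tagged_uncurry m p : Tagged P (uncurry m p) = tuncurry m (Tagged P p).
Proof. by elim: m => //= m <-; rewrite Tagged_ecast. Qed.

Lemma tuncurryD m n t : tuncurry (m + n) t = tuncurry n (tuncurry m t).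
Proof. by rewrite addnC; exact: iterD. Qed.

Lemma tcomp_uncurry m p (fs : seq T) : size fs = m ->
  tcomp (Tagged P (uncurry m p)) fs = foldl (@tapp P) (Tagged P p) fs.
Proof.
elim/last_ind: fs m => [|fs x IH] m; first by move=> <-; exact: tcomp1r.
rewrite size_rcons => <- /=; rewrite Tagged_ecast -cats1.
rewrite -[Tagged P _]/(tapp (Tagged P (uncurry _ p)) tid) tcomp_tapp //.
by rewrite IH // tcomp1l cats1 foldl_rcons.
Qed.

Lemma foldl_enumS n (F : 'I_n.+1 -> T) t :
  foldl (@tapp P) t [seq F i | i <- enum 'I_n.+1] =
  foldl (@tapp P) t [seq F (widen_ord (leqnSn n) i) | i <- enum 'I_n]
    * F ord_max.
Proof. by rewrite enum_ordSr map_rcons foldl_rcons -map_comp. Qed.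

End Uncurrying.

Section Extension.
Variables (A : extBI) (P : closed_operad) (h : extBI_hom A (p0_alg P)).
Local Notation T := {n & P n}.
Local Notation tid := (Tagged P oid).
Local Notation "x * y" := (tapp x y).
Let th (a : A) : T := Tagged P (h a : P 0).

Lemma Tagged_ap a b : th (a ⋅ b) = th a * th b.
Proof. by rewrite /th ahom_ap -p0_apE. Qed.

Lemma Tagged_B x y z : th cB * x * y * z = x * (y * z).
Proof. by rewrite /th ahom_B p0_BE. Qed.

Lemma Tagged_I x : th cI * x = x.
Proof. by rewrite /th ahom_I p0_IE. Qed.

Lemma Tagged_bul a x : th (a^•) * x = x * th a.
Proof. by rewrite /th ahom_bul p0_bulE. Qed.

(** Each argument [y] lowers the exponent: [B^(k+1) f t y = B^k f (t y)]; hence the induction varies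
    [t]. *)
Lemma foldl_Bpow f t (ys : seq T) :
  foldl (@tapp P) (th (Bpow A (size ys)) * f * t) ys =
  f * foldl (@tapp P) t ys.
Proof.
elim: ys t => [|y ys IH] t /=; first by rewrite Tagged_I.
by rewrite /circ !Tagged_ap !Tagged_B IH.
Qed.

Lemma tuncurry_Bpow k f t :
  tuncurry k (th (Bpow A k) * f * t) = f * tuncurry k t.
Proof.
have tuncurryE u : tuncurry k u = foldl (@tapp P) u (nseq k tid).
  by by elim: k u => //= k IH u; rewrite -IH /tuncurry -iterSr.
by rewrite !tuncurryE -{1}(size_nseq k tid) foldl_Bpow.
Qed.

(** For [f = a^• ∘ B^k], [f t = B^k t a] and [f ⋅ I = a], so the [k] identities are absorbed by
    [a]. *)
Lemma tuncurry_internal k f t : internal k f ->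
  tuncurry k (th f * t) = t * tuncurry k (th (f ⋅ cI)).
Proof.
move=> [a ->]; rewrite circE Bpow_ap1 ap_bul apI /circ !Tagged_ap Tagged_B.
by rewrite Tagged_bul tuncurry_Bpow.
Qed.

Lemma tuncurry_prod n (k : 'I_n -> nat) (f : 'I_n -> A) a :
  (forall i, internal (k i) (f i)) ->
  tuncurry (\sum_(i < n) k i) (th (internal_prod f ⋅ a)) =
  foldl (@tapp P) (th a) [seq tuncurry (k i) (th (f i ⋅ cI)) | i <- enum 'I_n].
Proof.
elim: n k f a => [|n IH] k f a fP.
  by rewrite /internal_prod !big_ord0 (size0nil (size_enum_ord 0)) apI.
rewrite internal_prodS big_ord_recr /= circE tuncurryD.
(* The induction hypothesis is used at [B^n f_n a] in place of [a]. Moving [f_n] out of the fold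
   then lets the last [k_n] identities build the last argument. *)
rewrite (IH (fun i => k (widen_ord _ i))) // foldl_enumS !Tagged_ap.
set ys := map _ _; have {2}<- : size ys = n by rewrite size_map size_enum_ord.
by rewrite foldl_Bpow tuncurry_internal ?Tagged_ap.
Qed.

Definition ext_map (m : nat) (x : internal_ops A m) : P m :=
  uncurry m (h (sval x ⋅ cI)).

Lemma Tagged_ext_map m x :
  Tagged P (@ext_map m x) = tuncurry m (th (sval x ⋅ cI)).
Proof. exact: Tagged_uncurry. Qed.

Definition ext_hom : closed_operad_hom (internal_closed_operad A) P.
Proof.
exists ext_map => [|n k g f|]; apply: eq_from_Tagged.
- by rewrite Tagged_ext_map /= apI Tagged_I.
(* With [a = g ⋅ I], both sides become the same iterated application starting at [h (g ⋅ I)]. *)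
- rewrite Tagged_ext_map circE tuncurry_prod => [|i]; last exact: svalP.
  rewrite -(tcomp_uncurry (m := n)); last by rewrite size_map size_enum_ord.
  apply: eq_ocomp => i; rewrite taggedK (nth_map i) ?size_enum_ord //.
  by rewrite nth_ord_enum Tagged_ext_map.
(* Since [B ⋅ I = I], the image of [B] is [(I id) id = app(id, id) = app]. *)
- rewrite Tagged_ext_map /= ax_BI Tagged_I tappE.
  by rewrite -[RHS]tcomp1r; apply: eq_ocomp => -[[|[|//]] i].
Defined.

End Extension.

Lemma ohom_uncurry (P Q : closed_operad) (w : closed_operad_hom P Q) m p :
  w m (uncurry m p) = uncurry m (w 0 p).
Proof.
elim: m => //= m IH; rewrite ohom_ecast.
by rewrite (ohom_comp2 w oapp (uncurry m p) oid) IH ohom_app ohom_id.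
Qed.

Lemma internal_uncurry (A : extBI) m (x : internal_ops A m) :
  uncurry (P := internal_closed_operad A) m
    (internal_unit_map (sval x ⋅ cI)) = x.
Proof.
have uncE n p : sval (uncurry (P := internal_closed_operad A) n p)
    = sval p ∘ Bpow A n.
  elim: n => [|n IH]; first by rewrite circ1r.
  (* In the internal operad [app(p, id)] is [p ∘ B], so each uncurrying contributes one factor
     [B]. *)
  rewrite BpowSr circA -IH /=.
  have sval_ecast i j (e : i = j) (z : internal_ops A i) :
    sval (ecast k (internal_ops A k) e z) = sval z by case: _ / e.
  by rewrite sval_ecast internal_ocomp2 /= ax_BI circ1r.
by apply: internal_ops_eq; rewrite uncE /= (internal_apI (svalP x)).
Qed.

Theorem theorem4p7 : left_adjoint internal_functor p0_functor.
Proof.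
exists (fun A P w => extBI_comp (p0_hom w) (internal_unit A)); split.
  move=> A P; exists (@ext_hom A P) => [w|h].
    apply: closed_operad_hom_ext => m x.
    by rewrite -[in RHS](internal_uncurry x) ohom_uncurry.
  (* On nullary operations the extension sends [a^•] to [h (a^• ⋅ I) = h a]. *)
  by apply: extBI_hom_ext => a; rewrite /= /ext_map /= ap_bul apI.
move=> A A' P P' u v w; apply: extBI_hom_ext => a /=.
(* Naturality reduces to [u (a^•) = (u a)^•]. *)
by congr (v _ (w _ _)); apply: internal_ops_eq; rewrite /= ahom_bul.
Qed.
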